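(* Let $G,H$ be graphs, and let $\odot$ denote a graph product. (i) If $\odot$ is either the lexicographic product, or the strong product, or the co-normal product, then $b(G\odot H)\ge b(G)\,b(H)$. (ii) If $\odot$ is the cartesian product or the direct product, then $b(G\odot H)\ge \max\{b(G),b(H)\}$.
   Context: Graphs are finite, simple and nonempty. A proper coloring of $G$ with $k$ colors is $f:V(G)\to\{1,\dots,k\}$ with $f(u)\ne f(v)$ for every edge $uv$. A vertex $v$ is a b-vertex of $f$ if it has at least one neighbor in every color class $j\in\{1,\dots,k\}$, $j\neq f(v)$. A b-coloring with $k$ colors is a proper coloring with $k$ colors in which each of the $k$ color classes contains a b-vertex. $b(G)$ (the b-chromatic number) is the largest $k$ such that $G$ has a b-coloring with $k$ colors. All products have vertex set $V(G)\times V(H)$; write $u\sim v$ for adjacency. Vertices $(u_a,v_a)$ and $(u_b,v_b)$ are adjacent in: the cartesian product iff ($u_a=u_b$ and $v_a\sim v_b$) or ($u_a\sim u_b$ and $v_a=v_b$); the direct product iff $u_a\sim u_b$ and $v_a\sim v_b$; the lexicographic product iff $u_a\sim u_b$ or ($u_a=u_b$ and $v_a\sim v_b$); the strong product iff ($u_a=u_b$ and $v_a\sim v_b$) or ($u_a\sim u_b$ and $v_a=v_b$) or ($u_a\sim u_b$ and $v_a\sim v_b$); the co-normal product iff $u_a\sim u_b$ or $v_a\sim v_b$.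
   Formalization: For the direct product, the bound is stated only when both graphs have an edge or neither does; if exactly one is edgeless the product is edgeless with b = 1 while the maximum is at least 2 (e.g. G = K_2, H = K_1), so the original claim fails there. *)

(* Defs.v *)
From mathcomp Require Import all_boot.

Set Implicit Arguments.
Unset Strict Implicit.
Unset Printing Implicit Defensive.

Record sgraph := SGraph {
  vertex :> finType;
  adj : rel vertex;
  adj_sym : symmetric adj;
  adj_irr : irreflexive adj }.

Notation "u -- v" := (adj u v) (at level 30, no associativity).

(* Used only for the direct product: if exactly one of G, H is edgeless, then
   the direct product is edgeless, so its b-chromatic number is 1 (for nonempty
   G and H), although max(b(G), b(H)) >= 2; for instance G = K_2, H = K_1. *)
Definition has_edge (G : sgraph) : bool := [exists u : G, exists v : G, u -- v].

Section Colorings.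
Variables (G : sgraph) (k : nat).
Implicit Types (f : {ffun G -> 'I_k}) (v : G).

Definition proper_coloring f : bool :=
  [forall u : G, forall v : G, (u -- v) ==> (f u != f v)].

Definition b_vertex f v : bool :=
  [forall j : 'I_k, (j != f v) ==> [exists w : G, (v -- w) && (f w == j)]].

Definition b_coloring f : bool :=
  proper_coloring f &&
  [forall j : 'I_k, exists v : G, (f v == j) && b_vertex f v].

Definition has_b_coloring : bool :=
  [exists f : {ffun G -> 'I_k}, b_coloring f].

End Colorings.

(* A proper coloring with the fewest colors is a b-coloring: a class without a
   b-vertex could be emptied by recoloring each of its vertices. *)
Lemma has_b_coloring_ex (G : sgraph) : exists k, has_b_coloring G k.
Proof.
pose P k := [exists f : {ffun G -> 'I_k}, proper_coloring f].
have exP : exists k, P k.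
  exists #|G|; apply/existsP; exists [ffun v => enum_rank v].
  apply/forallP=> u; apply/forallP=> v; apply/implyP=> uv; rewrite !ffunE.
  by apply: contraTneq uv => /enum_rank_inj ->; rewrite adj_irr.
case: (ex_minnP exP) => k /existsP[f fP] kmin; exists k.
apply/existsP; exists f; rewrite /b_coloring fP /=.
apply/forallP=> c; apply: contraT => /existsPn noB.
case: k f c fP kmin noB => [|k] f c fP kmin noB; first by case: c noB.
have [g gP] : exists g : G -> 'I_k.+1, forall v, f v = c ->
    g v != c /\ forall w, v -- w -> f w != g v.
  pose g v := odflt c [pick j | (j != c) &&
                         [forall w : G, (v -- w) ==> (f w != j)]].
  exists g => v fv; rewrite /g; case: pickP => [j /andP[jc /forallP jw]|no] /=.
    by split=> // w vw; have /implyP := jw w; apply.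
  case/negP: (noB v); rewrite fv eqxx /=.
  apply/forallP=> j; apply/implyP; rewrite fv => jc.
  apply: contraT => /existsPn nw; have:= no j; rewrite jc /= => /negP[].
  by apply/forallP=> w; apply/implyP=> vw; have:= nw w; rewrite vw.
pose h v := if f v == c then g v else f v.
have hc v : c != h v.
  rewrite eq_sym /h; case: (f v =P c) => [fv|/eqP //].
  by case: (gP v fv).
have properf u v : u -- v -> f u != f v.
  by move=> uv; have /forallP/(_ u)/forallP/(_ v)/implyP := fP; apply.
have properh u v : u -- v -> h u != h v.
  move=> uv; rewrite /h; case: (f u =P c) => fu; case: (f v =P c) => fv.
  - by have:= properf _ _ uv; rewrite fu fv eqxx.
  - by rewrite eq_sym; have [_] := gP _ fu; apply.
  - by have [_] := gP _ fv; apply; rewrite adj_sym.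
  - exact: properf.
have /kmin : P k; last by rewrite ltnn.
apply/existsP; exists [ffun v => sval (unlift_some (hc v))].
apply/forallP=> u; apply/forallP=> v; apply/implyP=> uv; rewrite !ffunE.
case: unlift_some => a /= au _; case: unlift_some => b /= bv _.
by have:= properh _ _ uv; rewrite au bv; apply: contra => /eqP ->.
Qed.

Lemma has_b_coloring_le_card (G : sgraph) k : has_b_coloring G k -> k <= #|G|.
Proof.
case/existsP=> f /andP[_ /forallP fB].
rewrite -[k in k <= _]card_ord; have <- : #|codom f| = #|'I_k|.
  apply: eq_card => j; rewrite [RHS]inE; apply/codomP.
  by have /existsP[v /andP[/eqP <- _]] := fB j; exists v.
exact: leq_image_card.
Qed.

Definition b_chromatic (G : sgraph) : nat :=
  ex_maxn (has_b_coloring_ex G) (@has_b_coloring_le_card G).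

Section Products.
Variables G H : sgraph.
Implicit Types a b : (G * H)%type.

Definition cartesian_adj a b : bool :=
  (a.1 == b.1) && (a.2 -- b.2) || (a.1 -- b.1) && (a.2 == b.2).

Definition direct_adj a b : bool := (a.1 -- b.1) && (a.2 -- b.2).

Definition lexicographic_adj a b : bool :=
  (a.1 -- b.1) || (a.1 == b.1) && (a.2 -- b.2).

Definition strong_adj a b : bool :=
  [|| (a.1 == b.1) && (a.2 -- b.2),
      (a.1 -- b.1) && (a.2 == b.2)
    | (a.1 -- b.1) && (a.2 -- b.2)].

Definition conormal_adj a b : bool := (a.1 -- b.1) || (a.2 -- b.2).

Lemma cartesian_sym : symmetric cartesian_adj.
Proof.
move=> a b; rewrite /cartesian_adj (eq_sym a.1) (eq_sym a.2).
by rewrite (adj_sym a.1) (adj_sym a.2).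
Qed.

Lemma cartesian_irr : irreflexive cartesian_adj.
Proof. by move=> a; rewrite /cartesian_adj !adj_irr andbF. Qed.

Lemma direct_sym : symmetric direct_adj.
Proof.
by move=> a b; rewrite /direct_adj (adj_sym a.1) (adj_sym a.2).
Qed.

Lemma direct_irr : irreflexive direct_adj.
Proof. by move=> a; rewrite /direct_adj adj_irr. Qed.

Lemma lexicographic_sym : symmetric lexicographic_adj.
Proof.
move=> a b; rewrite /lexicographic_adj (eq_sym a.1).
by rewrite (adj_sym a.1) (adj_sym a.2).
Qed.

Lemma lexicographic_irr : irreflexive lexicographic_adj.
Proof. by move=> a; rewrite /lexicographic_adj !adj_irr andbF. Qed.

Lemma strong_sym : symmetric strong_adj.
Proof.
move=> a b; rewrite /strong_adj (eq_sym a.1) (eq_sym a.2).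
by rewrite (adj_sym a.1) (adj_sym a.2).
Qed.

Lemma strong_irr : irreflexive strong_adj.
Proof. by move=> a; rewrite /strong_adj !adj_irr andbF. Qed.

Lemma conormal_sym : symmetric conormal_adj.
Proof.
by move=> a b; rewrite /conormal_adj (adj_sym a.1) (adj_sym a.2).
Qed.

Lemma conormal_irr : irreflexive conormal_adj.
Proof. by move=> a; rewrite /conormal_adj !adj_irr. Qed.

Definition cartesian_product := SGraph cartesian_sym cartesian_irr.
Definition direct_product := SGraph direct_sym direct_irr.
Definition lexicographic_product := SGraph lexicographic_sym lexicographic_irr.
Definition strong_product := SGraph strong_sym strong_irr.
Definition conormal_product := SGraph conormal_sym conormal_irr.

End Products.

(* Main.v *)
Require Import Defs.
From mathcomp Require Import all_boot.
From mathcomp Require Import ssralg zmodp.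

Set Implicit Arguments.
Unset Strict Implicit.
Unset Printing Implicit Defensive.

(** Each bound comes from a coloring of the product built from optimal
    b-colorings [c] of [G] and [d] of [H].

    For the product of the two numbers, color [(u, v)] by the pair
    [(c u, d v)].  This is proper even with all the edges of the co-normal
    product, and the fewer edges of the strong product already suffice to turn
    a pair of b-vertices into a b-vertex.  The lexicographic product lies
    between these two, so one argument covers every graph in the interval from
    the strong to the co-normal product ([b_chromatic_pair]).

    For the cartesian product, let [b(H) <= b(G) = k], exchanging the factors
    if necessary.  Then [d] can be read as a proper coloring with values in
    Z/k, and so can [c]; color [(u, v)] by [c u + d v].  On the layer over a
    fixed [v] this is [c] up to a translation of the colors, so the b-vertices
    of [c] give b-vertices of every color ([b_chromatic_cartesian_l]).

    For the direct product, the projection to a factor is a homomorphism, and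
    it maps the neighbors of [(u, v)] onto all the neighbors of [u] as soon as
    [v] is not isolated.  Hence the b-coloring of that factor pulls back to
    the product ([b_chromatic_lift]).  This needs an edge in the other factor;
    if neither factor has an edge, both b-chromatic numbers are at most 1,
    while that of any nonempty graph is at least 1. *)

(** * b-colorings with values in an arbitrary finite type *)

Definition proper_col (G : sgraph) (C : Type) (c : G -> C) : Prop :=
  forall u v : G, u -- v -> c u <> c v.

Definition sees_all (G : sgraph) (C : Type) (c : G -> C) (v : G) : Prop :=
  forall j, j <> c v -> exists2 w : G, v -- w & c w = j.

(** A b-coloring whose colors form any type, so that colors may be pairs or
    residues. *)
Definition b_col (G : sgraph) (C : Type) (c : G -> C) : Prop :=
  proper_col c /\ forall j, exists2 v, c v = j & sees_all c v.

Lemma b_col_chromatic (G : sgraph) (C : finType) (c : G -> C) :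
  b_col c -> #|C| <= b_chromatic G.
Proof.
case=> cP cB; rewrite /b_chromatic; case: ex_maxnP => k _; apply.
apply/existsP; exists [ffun v => enum_rank (c v)]; apply/andP; split.
  apply/'forall_forallP => u v; apply/implyP => uv; rewrite !ffunE.
  by apply/eqP => /enum_rank_inj; apply: cP.
apply/forallP => j; have [v cv vB] := cB (enum_val j).
apply/existsP; exists v; rewrite ffunE cv enum_valK eqxx /=.
apply/forallP => i; apply/implyP; rewrite ffunE cv enum_valK => ij.
have [|w vw cw] := vB (enum_val i).
  by rewrite cv => /enum_val_inj eij; rewrite eij eqxx in ij.
by apply/existsP; exists w; rewrite vw ffunE cw enum_valK eqxx.
Qed.

Lemma b_chromatic_col (G : sgraph) :
  exists c : G -> 'I_(b_chromatic G), b_col c.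
Proof.
rewrite /b_chromatic; case: ex_maxnP => k /existsP[f /andP[fP fB]] _.
exists f; split=> [u v uv | j].
  by apply/eqP; have /'forall_forallP/(_ u v)/implyP := fP; apply.
have /existsP[v /andP[/eqP fv /forallP vB]] := forallP fB j.
exists v => // i /eqP ij; have /existsP[w /andP[vw /eqP fw]] := implyP (vB i) ij.
by exists w.
Qed.

Lemma b_chromatic_gt0 (G : sgraph) : 0 < #|G| -> 0 < b_chromatic G.
Proof.
case/card_gt0P=> v _; have [c _] := b_chromatic_col G.
exact: leq_ltn_trans (leq0n _) (ltn_ord (c v)).
Qed.

(** With two colors, a b-vertex of the first has a neighbor of the second. *)
Lemma b_chromatic_edgeless (G : sgraph) : ~~ has_edge G -> b_chromatic G <= 1.
Proof.
move=> noE; rewrite leqNgt; apply/negP => k_gt1.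
have [c [_ cB]] := b_chromatic_col G.
have [v cv vB] := cB (Ordinal (ltnW k_gt1)).
have [|w vw _] := vB (Ordinal k_gt1); first by rewrite cv => /(congr1 val).
by case/negP: noE; apply/existsP; exists v; apply/existsP; exists w.
Qed.

(** Colorings pull back along a homomorphism; a b-vertex [p] remains one
    because some vertex over [p] has neighbors over all neighbors of [p]. *)
Lemma b_chromatic_lift (P Q : sgraph) (h : Q -> P) :
    (forall x y, x -- y -> h x -- h y) ->
    (forall p, exists2 x, h x = p &
       forall p', p -- p' -> exists2 y, x -- y & h y = p') ->
  b_chromatic P <= b_chromatic Q.
Proof.
move=> hom lift; have [c [cP cB]] := b_chromatic_col P.
rewrite -[leqLHS]card_ord; apply: (@b_col_chromatic Q _ (c \o h)); split.
  by move=> x y /hom; apply: cP.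
move=> j; have [p cp pB] := cB j; have [x hx xP] := lift p.
exists x => [|i /=]; rewrite /= hx // => ij.
have [p' pp' cp'] := pB i ij; have [y xy hy] := xP p' pp'.
by exists y; rewrite //= hy.
Qed.

(** * Products between the strong and the co-normal product *)

Lemma b_chromatic_pair (G H : sgraph) (e : rel (G * H))
    (e_sym : symmetric e) (e_irr : irreflexive e) :
    subrel (@strong_adj G H) e -> subrel e (@conormal_adj G H) ->
  b_chromatic G * b_chromatic H <= b_chromatic (SGraph e_sym e_irr).
Proof.
move=> strong_e e_conormal.
have [c [cP cB]] := b_chromatic_col G; have [d [dP dB]] := b_chromatic_col H.
rewrite -[b_chromatic G]card_ord -[b_chromatic H]card_ord -card_prod.
apply: (@b_col_chromatic (SGraph e_sym e_irr) _ (fun x => (c x.1, d x.2))).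
split=> [x y /e_conormal/orP[/cP ? | /dP ?] [] //|[i j]].
have [u cu uB] := cB i; have [v dv vB] := dB j.
exists (u, v) => [|[i' j']] /=; first by rewrite cu dv.
rewrite cu dv => ne; case: (i' =P i) (j' =P j) => [ei | /eqP ni] [ej | /eqP nj].
- by rewrite ei ej in ne.
- have [|w vw dw] := vB j'; first by rewrite dv; apply/eqP.
  exists (u, w); rewrite /= ?cu ?dw ?ei //.
  by apply: strong_e; rewrite /strong_adj /= eqxx vw.
- have [|w uw cw] := uB i'; first by rewrite cu; apply/eqP.
  exists (w, v); rewrite /= ?dv ?cw ?ej //.
  by apply: strong_e; rewrite /strong_adj /= eqxx uw orbT.
- have [|w uw cw] := uB i'; first by rewrite cu; apply/eqP.
  have [|z vz dz] := vB j'; first by rewrite dv; apply/eqP.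
  exists (w, z); rewrite /= ?dz ?cw //.
  by apply: strong_e; rewrite /strong_adj /= uw vz !orbT.
Qed.

Lemma strong_sub_lexicographic (G H : sgraph) :
  subrel (@strong_adj G H) (@lexicographic_adj G H).
Proof.
move=> x y; rewrite /strong_adj /lexicographic_adj.
by case/or3P => [-> | /andP[-> _] | /andP[-> _]]; rewrite ?orbT.
Qed.

Lemma lexicographic_sub_conormal (G H : sgraph) :
  subrel (@lexicographic_adj G H) (@conormal_adj G H).
Proof.
by move=> x y /orP[xy | /andP[_ xy]]; rewrite /conormal_adj xy ?orbT.
Qed.

(** * The cartesian product *)

(** Adding a proper coloring of [H] translates the colors of each layer
    [G * {v}], which preserves b-vertices. *)
Lemma b_col_cartesian_add (G H : sgraph) (n : nat)
    (c : G -> 'I_n.+1) (d : H -> 'I_n.+1) :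
    0 < #|H| -> b_col c -> proper_col d ->
  b_col (fun x : cartesian_product G H => (c x.1 + d x.2)%R).
Proof.
case/card_gt0P=> v _ [cP cB] dP; split.
  move=> [u x] [w y] /orP[]/andP[] /=.
    by move=> /eqP -> /dP xy /GRing.addrI.
  by move=> /cP uw /eqP -> /GRing.addIr.
move=> j; have [u cu uB] := cB (j - d v)%R.
exists (u, v) => [|i] /=; rewrite cu GRing.subrK // => ij.
have [|w uw cw] := uB (i - d v)%R; first by rewrite cu => /GRing.addIr.
exists (w, v); last by rewrite /= cw GRing.subrK.
by rewrite /= /cartesian_adj /= uw eqxx orbT.
Qed.

Lemma b_chromatic_cartesian_l (G H : sgraph) :
    0 < #|G| -> 0 < #|H| -> b_chromatic H <= b_chromatic G ->
  b_chromatic G <= b_chromatic (cartesian_product G H).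
Proof.
move=> hG hH; have := b_chromatic_gt0 hG.
have [c cB] := b_chromatic_col G; have [d [dP _]] := b_chromatic_col H.
case: (b_chromatic G) c cB => // n c cB _ leHG; rewrite -[leqLHS]card_ord.
have dP' : proper_col (fun v => widen_ord leHG (d v)).
  by move=> x y /dP xy /(congr1 val)/= /val_inj.
exact: b_col_chromatic (b_col_cartesian_add hH cB dP').
Qed.

Lemma b_chromatic_cartesian_swap (G H : sgraph) :
  b_chromatic (cartesian_product G H) <= b_chromatic (cartesian_product H G).
Proof.
have hom G' H' (x y : cartesian_product G' H') :
    x -- y -> ((x.2, x.1) : cartesian_product H' G') -- (y.2, y.1).
  by rewrite /= /cartesian_adj /= orbC andbC [X in _ || X]andbC.
apply: (@b_chromatic_lift (cartesian_product G H) (cartesian_product H G)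
  (fun x => (x.2, x.1))) => [x y|[u v]].
  exact: hom.
by exists (v, u) => // -[w z] /hom; exists (z, w).
Qed.

(** * The direct product *)

Lemma b_chromatic_direct_l (G H : sgraph) :
  has_edge H -> b_chromatic G <= b_chromatic (direct_product G H).
Proof.
case/existsP=> v /existsP[w vw].
apply: (b_chromatic_lift (h := fun x : direct_product G H => x.1)).
  by move=> x y /andP[].
move=> u; exists (u, v) => // u' uu'; exists (u', w) => //.
by rewrite /= /direct_adj /= uu' vw.
Qed.

Lemma b_chromatic_direct_r (G H : sgraph) :
  has_edge G -> b_chromatic H <= b_chromatic (direct_product G H).
Proof.
case/existsP=> v /existsP[w vw].
apply: (b_chromatic_lift (h := fun x : direct_product G H => x.2)).
  by move=> x y /andP[].
move=> u; exists (v, u) => // u' uu'; exists (w, u') => //.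
by rewrite /= /direct_adj /= uu' vw.
Qed.

(** * The bounds for the five products *)

Theorem theorem1 (G H : sgraph) (hG : 0 < #|G|) (hH : 0 < #|H|) :
  [/\ b_chromatic G * b_chromatic H <= b_chromatic (lexicographic_product G H),
      b_chromatic G * b_chromatic H <= b_chromatic (strong_product G H)
    & b_chromatic G * b_chromatic H <= b_chromatic (conormal_product G H)]
  /\
  (maxn (b_chromatic G) (b_chromatic H) <= b_chromatic (cartesian_product G H)
   /\ ((has_edge G <-> has_edge H) ->
       maxn (b_chromatic G) (b_chromatic H)
         <= b_chromatic (direct_product G H))).
Proof.
have sub_SL := @strong_sub_lexicographic G H.
have sub_LC := @lexicographic_sub_conormal G H.
split; first by split; apply: b_chromatic_pair => // x y /sub_SL/sub_LC.
split=> [|edgeGH].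
  case: (leqP (b_chromatic G) (b_chromatic H)) => [leGH | /ltnW leHG].
    apply: leq_trans (b_chromatic_cartesian_swap H G).
    exact: b_chromatic_cartesian_l.
  exact: b_chromatic_cartesian_l.
rewrite geq_max; have [eG | nG] := boolP (has_edge G).
  by rewrite b_chromatic_direct_l ?b_chromatic_direct_r //; apply/edgeGH.
have nH : ~~ has_edge H by apply/negP => /edgeGH; apply/negP.
have b_gt0 : 0 < b_chromatic (direct_product G H).
  by apply: b_chromatic_gt0; rewrite card_prod muln_gt0 hG.
by rewrite !(leq_trans (b_chromatic_edgeless _) b_gt0).
Qed.
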